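(* Let $v \geq 7$ be an odd integer. If there exists a $\mathrm{TTS}(v)$ with a Hamiltonian $2$-BIG, then there exists a $\mathrm{TTS}(3v+3)$ with a Hamiltonian $2$-BIG.
   Context: A twofold triple system of order $v$, denoted $\mathrm{TTS}(v)$, is a pair $(V,\mathcal{B})$ where $V$ is a set of $v$ points and $\mathcal{B}$ is a collection of $3$-element subsets of $V$ (called blocks or triples; repeated blocks are permitted, i.e. $\mathcal{B}$ is a multiset) such that each $2$-element subset of $V$ is contained in exactly two blocks of $\mathcal{B}$, counted with multiplicity. The $2$-block-intersection graph ($2$-BIG) of $(V,\mathcal{B})$ is the graph whose vertices are the blocks in $\mathcal{B}$ (repeated blocks giving distinct vertices), where two vertices $B_1,B_2$ are adjacent if and only if $|B_1\cap B_2|=2$. A graph is Hamiltonian if it contains a Hamilton cycle (a cycle, of length at least $3$, through all vertices). *)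

(* Defs.v *)
From mathcomp Require Import all_boot.

Set Implicit Arguments.
Unset Strict Implicit.
Unset Printing Implicit Defensive.

(* The multiset of blocks is a sequence: a repeated block is listed several
   times, and the order of the list plays no role. *)
Definition is_TTS (v : nat) (V : finType) (B : seq {set V}) : Prop :=
  [/\ #|V| = v,
      forall b : {set V}, b \in B -> #|b| = 3
    & forall e : {set V}, #|e| = 2 -> count (fun b : {set V} => e \subset b) B = 2].

(* Vertices are positions in B, so repeated blocks are distinct vertices. *)
Definition BIG2 (V : finType) (B : seq {set V}) : rel 'I_(size B) :=
  fun i j => #|tnth (in_tuple B) i :&: tnth (in_tuple B) j| == 2.
Arguments BIG2 {V} B.

Definition hamiltonian (T : finType) (e : rel T) : Prop :=
  exists c : seq T, [/\ 3 <= size c, ucycle e c & forall x : T, x \in c].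

(* Main.v *)
Require Import Defs.
From mathcomp Require Import all_boot.
From mathcomp Require Import zify.

(** For [m = (v + 1) / 2] a system of order [3 v + 3 = 6 m] is written down directly,
    together with a Hamilton cycle. The points are three layers of [Z_{2m}]. In
    each layer the complete graph on [Z_{2m}] splits into [m] zigzag Hamilton paths,
    the [j]-th one having ends [j] and [j + m]. Give every label [z] of the next
    layer such a path, with [z = j] and [z = j + m] sharing the pair of ends
    [j], [j + m], and turn the edges of the path into blocks by adding [z]. Each pair
    inside a layer is then covered twice, and so is each pair between consecutive
    layers except for the pairs (end of a path, its label). For every [j] these
    exceptional pairs form an octahedron, which is decomposed into four transversal
    triangles.

    The blocks of a label form a path in the 2-block-intersection graph. In
    layers 1 and 2 the labels [j] and [j + m] carry the same zigzag, so their two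
    block paths form a ladder; in layer 0 the label [j + m] carries the reflected
    zigzag, so that the last block of label [j] is adjacent to the last block of
    label [j + 1 + m]. For fixed [j] the two ladders and the four transversals can
    be traversed from the column of [j + m] to that of [j] in layer 0, and one then
    passes to [j + 1]. Passing from [m - 1] back to [0] reverses the orientation of
    the column, so [j = 0] gets a traversal of its own. *)

Set Implicit Arguments.
Unset Strict Implicit.
Unset Printing Implicit Defensive.

(** * Adjacent triples; criteria for a Hamiltonian 2-BIG and for a TTS *)

Definition adj_triple (W : finType) : rel {set W} :=
  fun X Y => [&& #|X| == 3, #|Y| == 3 & #|X :&: Y| == 2].

Lemma adj_triple_sym (W : finType) : symmetric (@adj_triple W).
Proof. by move=> X Y; rewrite /adj_triple setIC andbCA. Qed.

Lemma adj_tripleI (W : finType) (X Y : {set W}) (a b c : W) :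
  #|X| = 3 -> #|Y| = 3 -> a != b -> a \in X :&: Y -> b \in X :&: Y ->
  c \in X -> c \notin Y -> adj_triple X Y.
Proof.
move=> cX cY ab aXY bXY cinX cnY; rewrite /adj_triple cX cY !eqxx /=.
rewrite eqn_leq; apply/andP; split.
  rewrite -ltnS -cX; apply: proper_card; apply/properP; split; first exact: subsetIl.
  by exists c; rewrite // inE (negPf cnY) andbF.
rewrite -(_ : #|[set a; b]| = 2); last by rewrite cards2 ab.
by apply: subset_leq_card; apply/subsetP => x; rewrite !in_set2 => /orP[] /eqP->.
Qed.

(** The positions of [C] in increasing order form the Hamilton cycle; they are distinct even if
    blocks repeat. *)
Lemma cycle_hamiltonian (W : finType) (C : seq {set W}) :
  3 <= size C -> cycle (@adj_triple W) C -> hamiltonian (BIG2 C).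
Proof.
move=> szC cycC; exists (enum 'I_(size C)); split.
- by rewrite size_enum_ord.
- rewrite /ucycle enum_uniq andbT.
  have : cycle (@adj_triple W) (in_tuple C) := cycC.
  rewrite -(map_tnth_enum (in_tuple C)) cycle_map.
  by apply: sub_cycle => i j /and3P[].
- by move=> x; rewrite mem_enum.
Qed.

(* Double counting: there is no room for any pair to be covered three times. *)
Lemma covering_is_TTS (W : finType) (C : seq {set W}) :
  (forall b : {set W}, b \in C -> #|b| = 3) -> 3 * size C = #|W| * #|W|.-1 ->
  (forall a b : W, a != b -> exists X Y : {set W},
     [/\ X \in C, Y \in C, X != Y, [set a; b] \subset X & [set a; b] \subset Y]) ->
  is_TTS #|W| C.
Proof.
move=> C3 szC cov; split=> //.
have ge2 (e : {set W}) : #|e| == 2 -> 2 <= count (fun b : {set W} => e \subset b) C.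
  move=> /cards2P[a [b [ab ->]]]; have [X [Y [XC YC XY aX aY]]] := cov a b ab.
  rewrite -size_filter.
  have sub: {subset [:: X; Y] <= [seq c : {set W} <- C | [set a; b] \subset c]}.
    by move=> c; rewrite !inE mem_filter => /orP[] /eqP->; apply/andP.
  by apply: (uniq_leq_size _ sub); rewrite /= inE XY.
(* Summed over blocks, each of which contains ['C(3, 2)] pairs, the count is [3 * size C]. So the
   bounds [ge2] are equalities in total, hence termwise. *)
have total : \sum_(e : {set W} | #|e| == 2) count (fun b : {set W} => e \subset b) C
             = \sum_(e : {set W} | #|e| == 2) 2.
  rewrite sum_nat_const -cardsE card_draws.
  under eq_bigr => e _ do rewrite -sum1_count big_mkcond /=.
  rewrite exchange_big /= (eq_big_seq (fun=> 3)); last first.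
    move=> b /C3 b3; rewrite -big_mkcondr sum1_card.
    rewrite -cardsE -[RHS]/'C(3, 2) -b3 -cards_draws.
    by apply: eq_card => e; rewrite !inE andbC.
  rewrite big_const_seq count_predT iter_addn_0 szC bin2 muln2 halfK oddM.
  by case: #|W| => //= n; rewrite andNb subn0.
move=> e /eqP e2.
have := leqif_sum (fun (e : {set W}) (e2 : #|e| == 2) => leqif_eq (ge2 e e2)).
by rewrite /leqif total eqxx => -[_ /esym/forall_inP/(_ e e2)/eqP].
Qed.

(** * Walks with prescribed ends and their concatenation *)

Lemma size_flatten_mkseq (T : Type) (g : nat -> seq T) c n :
  (forall k, size (g k) = c) -> size (flatten (mkseq g n)) = n * c.
Proof.
move=> gc; elim: n => [//|n IH].
by rewrite mkseqS flatten_rcons size_cat IH gc mulSnr.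
Qed.

Lemma mem_flatten_mkseq (T : eqType) (g : nat -> seq T) n k b :
  k < n -> b \in g k -> b \in flatten (mkseq g n).
Proof.
by move=> kn bk; apply/flattenP; exists (g k) => //; apply: map_f; rewrite mem_iota.
Qed.

Section Walks.

Variables (T : Type) (e : rel T).

Definition walk (x : T) (s : seq T) (y : T) : Prop :=
  if s is x' :: p then [/\ x' = x, path e x p & last x p = y] else False.

Lemma walk1 x : walk x [:: x] x.
Proof. by []. Qed.

Lemma walk2 x y : e x y -> walk x [:: x; y] y.
Proof. by move=> exy; split=> //=; rewrite exy. Qed.

Lemma walk_cons x u t v : e x u -> walk u t v -> walk x (x :: t) v.
Proof. by move=> exu; case: t => // u' p [-> pp lp]; split; rewrite //= exu. Qed.

Lemma walk_cat x s y u t v :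
  walk x s y -> e y u -> walk u t v -> walk x (s ++ t) v.
Proof.
case: s => // x' p [-> pp lp] eyu; case: t => // u' p' [-> pp' lp'].
by split; rewrite // ?cat_path ?last_cat /= ?lp ?pp ?eyu.
Qed.

Lemma walk_rev x s y : symmetric e -> walk x s y -> walk y (rev s) x.
Proof.
move=> se; case: s => // x' p [-> pp <-].
rewrite lastI rev_rcons; split=> //.
  by rewrite rev_path (eq_path (e' := e)) // => u w; rewrite se.
by case: p {pp} => //= z p; rewrite rev_cons last_rcons.
Qed.

Lemma walk_flatten (g : nat -> seq T) (x y : nat -> T) n :
  (forall k, k <= n -> walk (x k) (g k) (y k)) ->
  (forall k, k < n -> e (y k) (x k.+1)) ->
  walk (x 0) (flatten (mkseq g n.+1)) (y n).
Proof.
elim: n => [|n IH] wg eg; first by rewrite /= cats0; apply: wg.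
rewrite mkseqS flatten_rcons; apply: walk_cat (eg n _) (wg n.+1 _) => //.
by apply: IH => k kn; [apply: wg | apply: eg]; lia.
Qed.

Lemma walk_mkseq (f : nat -> T) n :
  (forall k, k < n -> e (f k) (f k.+1)) -> walk (f 0) (mkseq f n.+1) (f n).
Proof.
move=> ef.
suff -> : mkseq f n.+1 = flatten (mkseq (fun k => [:: f k]) n.+1).
  by apply: (walk_flatten (x := f)) => // k _; apply: walk1.
by rewrite /mkseq; elim: (iota 0 n.+1) => //= a s ->.
Qed.

Lemma walk_cycle x s y : walk x s y -> e y x -> cycle e s.
Proof. by case: s => // x' p [-> pp lp] eyx; rewrite /= rcons_path pp lp. Qed.

End Walks.

(** * Zigzag paths and the path assigned to each label *)

Section Construction.

Variable q : nat.
Hypothesis q_gt0 : 0 < q.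

Local Notation m := q.+1.
Local Notation h := (q.*2).+1.
Local Notation W := ('I_3 * 'I_h.+1)%type.
Local Notation l0 := (@Ordinal 3 0 isT).
Local Notation l1 := (@Ordinal 3 1 isT).
Local Notation l2 := (@Ordinal 3 2 isT).

(* Walecki's path [j, j + 1, j - 1, j + 2, j - 2, ..., j + m] modulo [2m = h.+1]. *)
Definition zigzag (j k : nat) : nat :=
  if odd k then j + uphalf k
  else if k./2 <= j then j - k./2 else j + h.+1 - k./2.

Lemma zigzag_le j k : j < m -> k <= h -> zigzag j k <= h.
Proof. by rewrite /zigzag => jm kh; repeat case: ifP => ?; lia. Qed.

Lemma zigzag_inj j k l : j < m -> k <= h -> l <= h ->
  zigzag j k = zigzag j l -> k = l.
Proof. by rewrite /zigzag => jm kh lh; repeat case: ifP => ?; lia. Qed.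

Lemma zigzag_onto j x : j < m -> x <= h -> exists2 k, k <= h & zigzag j k = x.
Proof.
move=> jm xh; rewrite /zigzag.
have [xj|xj] := leqP x j; first by exists (j - x).*2; repeat case: ifP => ?; lia.
have [xjm|xjm] := leqP x (j + m).
  by exists (x - j).*2.-1; repeat case: ifP => ?; lia.
by exists (j + h.+1 - x).*2; repeat case: ifP => ?; lia.
Qed.

(** Modulo [h.+1], entries [k] and [k.+1] of path [j] sum to [2j] or [2j + 1] and differ by [k + 1]
    up to sign. So the sum of [x] and [y] determines [j] and their difference [k]; the two cases are
    whether the sum wraps around. *)
Lemma zigzag_edge x y : x < y -> y <= h -> exists j k, [/\ j < m, k < h &
  (zigzag j k = x /\ zigzag j k.+1 = y) \/ (zigzag j k = y /\ zigzag j k.+1 = x)].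
Proof.
move=> xy yh; rewrite /zigzag.
have [s|s] := leqP (x + y) h.
  by exists (x + y)./2, (y - x).-1; split; repeat case: ifP => ?; lia.
by exists ((x + y)./2 - m), (h - (y - x)); split; repeat case: ifP => ?; lia.
Qed.

(* The second branch is the reflected path [j, j - 1, j + 1, ..., j + m] for
   [j = z - m]: it is [x |-> h - x] applied to the zigzag of [m - 1 - j = h - z],
   read backwards. *)
Definition route (i : 'I_3) (z k : nat) : nat :=
  if z < m then zigzag z k
  else if i == l0 then h - zigzag (h - z) (h - k) else zigzag (z - m) k.

Lemma route_le i z k : z <= h -> k <= h -> route i z k <= h.
Proof.
move=> zh kh; rewrite /route; case: ifP => zm; first exact: zigzag_le.
by case: ifP => _; [exact: leq_subr | apply: zigzag_le; lia].
Qed.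

Lemma route_inj i z k l : z <= h -> k <= h -> l <= h ->
  route i z k = route i z l -> k = l.
Proof.
move=> zh kh lh; rewrite /route; case: ifP => zm; first exact: zigzag_inj.
case: ifP => _; last by apply: zigzag_inj; lia.
have hz : h - z < m by lia.
have := zigzag_le hz (leq_subr k h); have := zigzag_le hz (leq_subr l h).
have := @zigzag_inj (h - z) (h - k) (h - l) hz (leq_subr _ _) (leq_subr _ _).
lia.
Qed.

Lemma route_onto i z x : z <= h -> x <= h -> exists2 k, k <= h & route i z k = x.
Proof.
move=> zh xh; rewrite /route; case zm: (z < m); first exact: zigzag_onto.
case: (i == l0); last by apply: zigzag_onto; lia.
have [||k kh e] := @zigzag_onto (h - z) (h - x); try lia.
by exists (h - k); [exact: leq_subr | rewrite (subKn kh) e; lia].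
Qed.

(** Each half of the labels, selected by [upper], carries every edge of the layer; this yields the
    two blocks through a pair inside a layer. *)
Lemma route_edge i (upper : bool) x y : x < y -> y <= h -> exists z k,
  [/\ z <= h, (m <= z) = upper, k < h &
    (route i z k = x /\ route i z k.+1 = y) \/
    (route i z k = y /\ route i z k.+1 = x)].
Proof.
move=> xy yh; have [j [k [jm kh E]]] := zigzag_edge xy yh.
case: upper; last by exists j, k; rewrite /route jm; split=> //; lia.
case i0 : (i == l0); last first.
  have zm : (j + m < m) = false by lia.
  by exists (j + m), k; rewrite /route i0 zm addnK; split=> //; lia.
(* On reflected paths, look up the reflected edge; reading backwards turns edge index [k'] into
   [h - k'.+1]. *)
have [||j' [k' [jm' kh' E']]] := @zigzag_edge (h - y) (h - x); try lia.
have zm : (h - j' < m) = false by lia.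
exists (h - j'), (h - k'.+1); rewrite /route i0 zm.
have -> : h - (h - j') = j' by lia.
have -> : h - (h - k'.+1) = k'.+1 by lia.
have -> : h - (h - k'.+1).+1 = k' by lia.
by split=> //; lia.
Qed.

Lemma route_first i z : z <= h -> route i z 0 = if z < m then z else z - m.
Proof. by move=> zh; rewrite /route /zigzag; repeat case: ifP => ?; lia. Qed.

Lemma route_last i z : z <= h -> route i z h = if z < m then z + m else z.
Proof. by move=> zh; rewrite /route /zigzag; repeat case: ifP => ?; lia. Qed.

(** * Points and the two kinds of blocks *)

Definition pt (i : 'I_3) (x : nat) : W := (i, inord x).

Lemma pt_eq i j x y : x <= h -> y <= h ->
  (pt i x == pt j y) = (i == j) && (x == y).
Proof.
by move=> xh yh; rewrite xpair_eqE; congr (_ && _); rewrite -val_eqE /= !inordK.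
Qed.

Lemma ord3P (i : 'I_3) : [\/ i = l0, i = l1 | i = l2].
Proof.
case: i => [[|[|[|//]]] ilt]; rewrite (bool_irrelevance ilt isT).
- exact: Or31.
- exact: Or32.
- exact: Or33.
Qed.

Lemma ordS_neq (i : 'I_3) : (i == ordS i) = false.
Proof. by case: (ord3P i) => ->. Qed.

Definition sector (i : 'I_3) (z k : nat) : {set W} :=
  [set pt i (route i z k); pt i (route i z k.+1); pt (ordS i) z].

Definition transverse_block (x y z : nat) : {set W} :=
  [set pt i (nth 0 [:: x; y; z] i) | i : 'I_3].

Lemma in_sector i j z k x : z <= h -> k < h -> x <= h ->
  (pt j x \in sector i z k) =
  (j == i) && ((x == route i z k) || (x == route i z k.+1))
  || (j == ordS i) && (x == z).
Proof.
move=> zh kh xh; have r0 := route_le i zh (ltnW kh); have r1 := route_le i zh kh.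
by rewrite !inE !pt_eq // -andb_orr.
Qed.

Lemma in_transversal a b c (i : 'I_3) x : a <= h -> b <= h -> c <= h -> x <= h ->
  (pt i x \in transverse_block a b c) = (x == nth 0 [:: a; b; c] i).
Proof.
move=> ah bh ch xh.
have th (l : 'I_3) : nth 0 [:: a; b; c] l <= h by case: l => [[|[|[|]]]].
apply/imsetP/eqP => [[l _ /eqP]|->]; last by exists i.
by rewrite pt_eq // => /andP[/eqP-> /eqP].
Qed.

Lemma card_sector i z k : z <= h -> k < h -> #|sector i z k| = 3.
Proof.
move=> zh kh; have r0 := route_le i zh (ltnW kh); have r1 := route_le i zh kh.
rewrite /sector -setUA cardsU1 cards2 !inE !pt_eq //.
rewrite eqxx ordS_neq /= orbF; case: eqP => //= /route_inj; lia.
Qed.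

Lemma card_transversal a b c : #|transverse_block a b c| = 3.
Proof. by rewrite card_imset ?card_ord // => i j [->]. Qed.

(** * Adjacencies between blocks *)

Local Notation adj := (@adj_triple W).

Lemma adj_sector_succ i z k : z <= h -> k.+1 < h ->
  adj (sector i z k) (sector i z k.+1).
Proof.
move=> zh kh.
have inj l l' := @route_inj i z l l' zh.
apply: (@adj_tripleI _ _ _ (pt i (route i z k.+1)) (pt (ordS i) z) (pt i (route i z k)));
  rewrite ?card_sector ?inE -/(pt _ _) ?in_sector ?pt_eq ?route_le ?ordS_neq ?eqxx
    ?orbT //; try lia.
rewrite /= orbF; apply/negP => /orP[] /eqP /inj; lia.
Qed.

Lemma adj_sector_label i z k z' k' : z <= h -> z' <= h -> k < h -> k' < h -> z != z' ->
  (route i z k = route i z' k' /\ route i z k.+1 = route i z' k'.+1) \/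
  (route i z k = route i z' k'.+1 /\ route i z k.+1 = route i z' k') ->
  adj (sector i z k) (sector i z' k').
Proof.
move=> zh zh' kh kh' zz' E.
apply: (@adj_tripleI _ _ _ (pt i (route i z k)) (pt i (route i z k.+1)) (pt (ordS i) z)).
- exact: card_sector.
- exact: card_sector.
- by rewrite pt_eq ?route_le ?eqxx //; try lia; apply/eqP => /route_inj; lia.
- by rewrite inE !in_sector ?route_le ?eqxx //=; lia.
- by rewrite inE !in_sector ?route_le ?eqxx ?orbT //=; lia.
- by rewrite in_sector // !eqxx orbT.
- by rewrite in_sector // eq_sym ordS_neq eqxx.
Qed.

Lemma adj_transversal a b c (i : 'I_3) z k :
  a <= h -> b <= h -> c <= h -> k < h ->
  nth 0 [:: a; b; c] (ordS i) = z ->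
  nth 0 [:: a; b; c] i = route i z k \/ nth 0 [:: a; b; c] i = route i z k.+1 ->
  adj (sector i z k) (transverse_block a b c).
Proof.
move=> ah bh ch kh tz ti.
have th (l : 'I_3) : nth 0 [:: a; b; c] l <= h by case: l => [[|[|[|]]]].
have zh : z <= h by rewrite -tz.
have tik : (nth 0 [:: a; b; c] i == route i z k)
    || (nth 0 [:: a; b; c] i == route i z k.+1).
  by case: ti => ->; rewrite eqxx ?orbT.
(* The other end of the path edge: a transversal has only one point in layer [i], so it misses
   [pt i x]. *)
pose x := if nth 0 [:: a; b; c] i == route i z k then route i z k.+1 else route i z k.
have xh : x <= h by rewrite /x; case: ifP => _; apply: route_le; lia.
apply: (@adj_tripleI _ _ _ (pt i (nth 0 [:: a; b; c] i)) (pt (ordS i) z) (pt i x)).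
- exact: card_sector.
- exact: card_transversal.
- by rewrite pt_eq // ordS_neq.
- by rewrite inE in_sector ?in_transversal ?eqxx ?tik.
- by rewrite inE in_sector ?in_transversal ?tz ?eqxx ?orbT.
- by rewrite in_sector // eqxx /x; case: ifP; rewrite eqxx ?orbT.
- rewrite in_transversal // /x; case: ifP ti => [/eqP-> _|/eqP ne [] // ->];
    apply/eqP => /route_inj; lia.
Qed.

(** * The cyclic order of the blocks *)

Definition column i z n := mkseq (sector i z) n.

(** Rungs are crossed in alternating directions. Their number [h] is odd, so the ladder is entered
    on side [j + m] and left on side [j]. *)
Definition snake j := flatten (mkseq (fun k =>
  if odd k then [:: sector l1 j k; sector l1 (j + m) k]
  else [:: sector l1 (j + m) k; sector l1 j k]) h).

(** Column [m] of layer 0 runs upwards, since the cycle closes at its first block. The layer-1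
    ladder is cut before its last rung; that of layer 2 is one U-turn. *)
Definition first_segment :=
  column l0 m h
  ++ transverse_block m m 0 :: [:: sector l1 0 q.*2; sector l1 m q.*2]
  ++ transverse_block 0 m m :: rev (column l2 0 h) ++ column l2 m h
  ++ transverse_block m 0 m :: column l1 m q.*2 ++ rev (column l1 0 q.*2)
  ++ transverse_block 0 0 0 :: column l0 0 h.

(** Here the layer-2 ladder is cut: its last rung is visited before the layer-1 snake, the rest
    after it as a U-turn. *)
Definition later_segment j :=
  rev (column l0 (j + m) h)
  ++ transverse_block j (j + m) (j + m) :: [:: sector l2 j q.*2; sector l2 (j + m) q.*2]
  ++ transverse_block (j + m) j (j + m) :: snake j
  ++ transverse_block (j + m) (j + m) j :: column l2 (j + m) q.*2 ++ rev (column l2 j q.*2)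
  ++ transverse_block j j j :: column l0 j h.

Definition segment j := if j is 0 then first_segment else later_segment j.

Definition blocks := flatten (mkseq segment m).

Lemma size_snake j : size (snake j) = h.*2.
Proof.
by rewrite (@size_flatten_mkseq _ _ 2) ?muln2 // => k; case: ifP.
Qed.

(** Six columns of [h] sectors and four transversals. *)
Lemma size_segment j : size (segment j) = 6 * h + 4.
Proof.
have szc i z n : size (column i z n) = n by rewrite size_mkseq.
have szT b (s : seq {set W}) : size (b :: s) = (size s).+1 by [].
case: j => [|j]; rewrite /segment /first_segment /later_segment;
  rewrite !(size_cat, szT, size_rev, szc, size_snake) [size [::]]/=; lia.
Qed.

Lemma size_blocks : size blocks = m * (6 * h + 4).
Proof. exact: size_flatten_mkseq size_segment. Qed.

(** * The segments are walks and close up into a cycle *)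

Lemma route_pair i j k : i != l0 -> j < m -> route i (j + m) k = route i j k.
Proof.
move=> i0 jm; have zm : (j + m < m) = false by lia.
by rewrite /route zm jm (negPf i0) addnK.
Qed.

Lemma adj_rung i j k : i != l0 -> j < m -> k < h ->
  adj (sector i j k) (sector i (j + m) k).
Proof.
by move=> i0 jm kh; apply: adj_sector_label; rewrite ?route_pair //; lia.
Qed.

Lemma walk_column i z n : z <= h -> 0 < n <= h ->
  walk adj (sector i z 0) (column i z n) (sector i z n.-1).
Proof.
case: n => // n zh nh; apply: walk_mkseq => k kn.
by apply: adj_sector_succ => //; lia.
Qed.

Lemma walk_rev_column i z n : z <= h -> 0 < n <= h ->
  walk adj (sector i z n.-1) (rev (column i z n)) (sector i z 0).
Proof.
by move=> zh nh; apply: walk_rev (walk_column _ zh nh); apply: adj_triple_sym.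
Qed.

Lemma walk_snake j : j < m ->
  walk adj (sector l1 (j + m) 0) (snake j) (sector l1 j q.*2).
Proof.
move=> jm.
pose x k := if odd k then sector l1 j k else sector l1 (j + m) k.
pose y k := if odd k then sector l1 (j + m) k else sector l1 j k.
have -> : sector l1 j q.*2 = y q.*2 by rewrite /y odd_double.
apply: (walk_flatten (x := x)) => k kq; rewrite /x /y.
  have rung := @adj_rung l1 j k isT jm kq.
  by case: ifP => _; apply: walk2; rewrite // adj_triple_sym.
by rewrite /=; case: (odd k) => /=; apply: adj_sector_succ; lia.
Qed.

Ltac adj_end :=
  first [apply: adj_transversal | rewrite adj_triple_sym; apply: adj_transversal];
  rewrite /= ?route_first ?route_last /=; repeat case: ifP => ?; lia.

Definition segment_start j :=
  if j is 0 then sector l0 m 0 else sector l0 (j + m) q.*2.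

Lemma walk_first_segment :
  walk adj (sector l0 m 0) first_segment (sector l0 0 q.*2).
Proof.
rewrite /first_segment.
apply: (walk_cat (y := sector l0 m q.*2) (u := transverse_block m m 0)).
- by apply: (@walk_column l0 m h); lia.
- adj_end.
apply: (walk_cons (u := sector l1 0 q.*2)); first adj_end.
apply: (walk_cons (u := sector l1 m q.*2)); first exact: (@adj_rung l1 0).
apply: (walk_cons (u := transverse_block 0 m m)); first adj_end.
apply: (walk_cons (u := sector l2 0 q.*2)); first adj_end.
apply: (walk_cat (y := sector l2 0 0) (u := sector l2 m 0)).
- by apply: (@walk_rev_column l2 0 h); lia.
- exact: (@adj_rung l2 0).
apply: (walk_cat (y := sector l2 m q.*2) (u := transverse_block m 0 m)).
- by apply: (@walk_column l2 m h); lia.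
- adj_end.
apply: (walk_cons (u := sector l1 m 0)); first adj_end.
apply: (walk_cat (y := sector l1 m q.*2.-1) (u := sector l1 0 q.*2.-1)).
- by apply: walk_column; lia.
- by rewrite adj_triple_sym; apply: (@adj_rung l1 0) => //; lia.
apply: (walk_cat (y := sector l1 0 0) (u := transverse_block 0 0 0)).
- by apply: walk_rev_column; lia.
- adj_end.
apply: (walk_cons (u := sector l0 0 0)); first adj_end.
by apply: (@walk_column l0 0 h); lia.
Qed.

Lemma walk_later_segment j : j < m ->
  walk adj (sector l0 (j + m) q.*2) (later_segment j) (sector l0 j q.*2).
Proof.
move=> jm; rewrite /later_segment.
apply: (walk_cat (y := sector l0 (j + m) 0) (u := transverse_block j (j + m) (j + m))).
- by apply: (@walk_rev_column l0 (j + m) h); lia.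
- adj_end.
apply: (walk_cons (u := sector l2 j q.*2)); first adj_end.
apply: (walk_cons (u := sector l2 (j + m) q.*2)); first exact: adj_rung.
apply: (walk_cons (u := transverse_block (j + m) j (j + m))); first adj_end.
apply: (walk_cons (u := sector l1 (j + m) 0)); first adj_end.
apply: (walk_cat (y := sector l1 j q.*2) (u := transverse_block (j + m) (j + m) j)).
- exact: walk_snake.
- adj_end.
apply: (walk_cons (u := sector l2 (j + m) 0)); first adj_end.
apply: (walk_cat (y := sector l2 (j + m) q.*2.-1) (u := sector l2 j q.*2.-1)).
- by apply: walk_column; lia.
- by rewrite adj_triple_sym; apply: adj_rung => //; lia.
apply: (walk_cat (y := sector l2 j 0) (u := transverse_block j j j)).
- by apply: walk_rev_column; lia.
- adj_end.
apply: (walk_cons (u := sector l0 j 0)); first adj_end.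
by apply: (@walk_column l0 j h); lia.
Qed.

Lemma cycle_blocks : cycle adj blocks.
Proof.
apply: (@walk_cycle _ _ (segment_start 0) _ (sector l0 q q.*2)).
  apply: (@walk_flatten _ _ segment segment_start (fun j => sector l0 j q.*2)).
    by case=> [|j] jq; [apply: walk_first_segment | apply: walk_later_segment].
  (* The common edge joins [j + m] and [j + m + 1]; it is the last one on both paths, in opposite
     directions. *)
  move=> j jq; apply: adj_sector_label; try lia.
  right; rewrite /route /zigzag; split; repeat case: ifP => ?; lia.
(* The common edge joins [0] and [h]; it is the last one for label [q] and the first one for label
   [m], in the same direction. *)
apply: adj_sector_label; try lia.
left; rewrite /route /zigzag; split; repeat case: ifP => ?; lia.
Qed.

(** * Every pair of points lies in two blocks *)

Lemma label_split z : z <= h -> exists2 j, j < m & z = j \/ z = j + m.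
Proof.
move=> zh; have [zm|zm] := ltnP z m; first by exists z; [|left].
by exists (z - m); [lia | right; lia].
Qed.

Lemma mem_blocks j b : j < m -> b \in segment j -> b \in blocks.
Proof. exact: mem_flatten_mkseq. Qed.

Lemma mem_column i z n k : k < n -> sector i z k \in column i z n.
Proof. by move=> kn; apply: map_f; rewrite mem_iota. Qed.

Lemma mem_snake j k : k < h ->
  sector l1 j k \in snake j /\ sector l1 (j + m) k \in snake j.
Proof.
by move=> kh; split; apply: (mem_flatten_mkseq kh); case: ifP; rewrite !inE eqxx ?orbT.
Qed.

Lemma sector_blocks i z k : z <= h -> k < h -> sector i z k \in blocks.
Proof.
move=> zh kh.
have [j jm zj] := label_split zh.
apply: (mem_blocks jm); rewrite /segment /first_segment /later_segment.
have mc i' z' n := @mem_column i' z' n k.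
have ms j' := @mem_snake j' k kh.
(* Columns and snakes are generalized lest [in_cons] unfold them. *)
move: column snake mc ms => col sn mc ms.
have [s1 s2] := ms j; have mh i' z' := mc i' z' h kh.
(* Some columns stop at length [q.*2], their last rung being listed separately. *)
have [kq|kq] := eqVneq k q.*2.
  case: (ord3P i) => ->; case: j {jm} zj s1 s2 => [|j] [] ->; rewrite ?add0n => s1 s2;
    by rewrite !(mem_cat, mem_rev, in_cons) ?mh ?s1 ?s2 ?kq ?eqxx ?orbT.
have mq i' z' : sector i' z' k \in col i' z' q.*2 by apply: mc; lia.
case: (ord3P i) => ->; case: j {jm} zj s1 s2 => [|j] [] ->; rewrite ?add0n => s1 s2;
  by rewrite !(mem_cat, mem_rev, in_cons) ?mh ?mq ?s1 ?s2 ?orbT.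
Qed.

Lemma transversal_blocks j : j < m ->
  [/\ transverse_block j j j \in blocks, transverse_block (j + m) j (j + m) \in blocks,
      transverse_block j (j + m) (j + m) \in blocks &
      transverse_block (j + m) (j + m) j \in blocks].
Proof.
by case: j => [|j] jm; rewrite ?add0n; split; apply: (mem_blocks jm);
  rewrite /segment /first_segment /later_segment;
  move: column snake => col sn; rewrite !(mem_cat, in_cons) eqxx ?orbT.
Qed.

(** The four transversals of [j] are those with an even number of entries [j + m], so a choice in
    two layers always extends to one of them. *)
Lemma transversal_cover (i : 'I_3) z k : z <= h -> k = 0 \/ k = h -> exists a b c,
  [/\ [&& a <= h, b <= h & c <= h], transverse_block a b c \in blocks,
      nth 0 [:: a; b; c] i = route i z k & nth 0 [:: a; b; c] (ordS i) = z].
Proof.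
move=> zh k0.
have [j jm zj] := label_split zh.
have [T0 T1 T2 T3] := transversal_blocks jm.
have rk : route i z k = j \/ route i z k = j + m.
  case: k0 => ->; [left; rewrite route_first | right; rewrite route_last] => //;
  by case: ifP; lia.
case: (ord3P i) rk => -> [] ->; case: zj => ->;
  by first [exists j, j, j; split=> //=; lia
           | exists (j + m), j, (j + m); split=> //=; lia
           | exists j, (j + m), (j + m); split=> //=; lia
           | exists (j + m), (j + m), j; split=> //=; lia].
Qed.

Definition covered (a b : W) := exists X Y : {set W},
  [/\ X \in blocks, Y \in blocks, X != Y, [set a; b] \subset X & [set a; b] \subset Y].

Lemma coveredC a b : covered a b -> covered b a.
Proof. by rewrite /covered setUC. Qed.

(** Adjacency supplies distinctness: equal triples would meet in three points. *)
Lemma coveredI a b X Y : X \in blocks -> Y \in blocks -> adj X Y ->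
  a \in X :&: Y -> b \in X :&: Y -> covered a b.
Proof.
move=> Xb Yb XY; rewrite !inE => /andP[aX aY] /andP[bX bY]; exists X, Y.
split; rewrite // ?subUset ?sub1set ?aX ?aY //.
by apply: contraTneq XY => ->; rewrite /adj_triple setIid; case: eqP => // ->.
Qed.

Lemma covered_layer i x y : x < y -> y <= h -> covered (pt i x) (pt i y).
Proof.
move=> xy yh.
have [z [k [zh zm kh E]]] := route_edge i false xy yh.
have [z' [k' [zh' zm' kh' E']]] := route_edge i true xy yh.
have xh : x <= h by lia.
apply: (@coveredI _ _ (sector i z k) (sector i z' k')); try exact: sector_blocks.
- by apply: adj_sector_label => //; lia.
- by rewrite inE !in_sector // eqxx /=; lia.
- by rewrite inE !in_sector // eqxx /=; lia.
Qed.

(** An inner vertex of the path of [z] lies on two consecutive edges, giving two sectors; an end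
    lies on one edge, and a transversal is the second block. *)
Lemma covered_next i x z : x <= h -> z <= h -> covered (pt i x) (pt (ordS i) z).
Proof.
move=> xh zh; have [k kh kx] := route_onto i zh xh.
have [kend|kend] : (k = 0 \/ k = h) \/ 0 < k < h by lia.
  have [a [b [c [/and3P[ah bh ch] Tb ti tz]]]] := transversal_cover i zh kend.
  (* [l] is the index of the only path edge at that end; [q.*2] is [h - 1]. *)
  have [l [lh lk]] : exists l, l < h /\ (k = l \/ k = l.+1).
    by case: kend => ->; [exists 0 | exists q.*2]; split; lia.
  apply: (@coveredI _ _ (sector i z l) (transverse_block a b c)) => //.
  - exact: sector_blocks.
  - by apply: adj_transversal => //; rewrite ti; case: lk => ->; [left | right].
  - rewrite inE in_sector ?in_transversal // ti kx !eqxx /= -kx.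
    by case: lk => ->; rewrite eqxx ?orbT.
  - by rewrite inE in_sector ?in_transversal // tz !eqxx orbT.
case: k kh kx kend => // k kh kx kend.
apply: (@coveredI _ _ (sector i z k) (sector i z k.+1)).
- by apply: sector_blocks; lia.
- by apply: sector_blocks; lia.
- by apply: adj_sector_succ; lia.
- by rewrite inE !in_sector ?kx ?eqxx ?orbT //; lia.
- by rewrite inE !in_sector ?eqxx ?orbT //; lia.
Qed.

Lemma covered_all (a b : W) : a != b -> covered a b.
Proof.
have ptE (u : W) : u = pt u.1 u.2 by case: u => i x; rewrite /pt inord_val.
have le_h (u : W) : u.2 <= h by rewrite -ltnS.
rewrite (ptE a) (ptE b) pt_eq //.
(* Among three cyclically ordered layers, any two distinct ones are consecutive. *)
have /or3P[/eqP->|/eqP->|/eqP->] :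
    [|| b.1 == a.1, b.1 == ordS a.1 | a.1 == ordS b.1].
  by case: (ord3P a.1) => ->; case: (ord3P b.1) => ->.
- rewrite eqxx /= neq_ltn => /orP[ltab|ltba]; first exact: covered_layer.
  by apply: coveredC; apply: covered_layer.
- by move=> _; apply: covered_next.
- by move=> _; apply: coveredC; apply: covered_next.
Qed.

(** * Assembly and choice of the parameter *)

Lemma blocks_TTS : is_TTS (6 * m) blocks /\ hamiltonian (BIG2 blocks).
Proof.
have W6 : #|{: W}| = 6 * m by rewrite card_prod !card_ord; lia.
split; last first.
  by apply: cycle_hamiltonian cycle_blocks; rewrite size_blocks; lia.
rewrite -W6; apply: covering_is_TTS covered_all.
  (* [adj_triple] records cardinalities, so the edge from [b] to its successor shows that [b] is a
     triple. *)
  by move=> b bC; have /and3P[/eqP] := next_cycle cycle_blocks bC.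
(* With [h = 2m - 1], this is [3m(6h + 4) = 6m(6m - 1)]. *)
rewrite size_blocks W6; nia.
Qed.

End Construction.

Theorem theorem8p1 (v : nat) (v_ge7 : 7 <= v) (v_odd : odd v) :
  (exists (V : finType) (B : seq {set V}), is_TTS v B /\ hamiltonian (BIG2 B)) ->
  exists (W : finType) (C : seq {set W}),
    is_TTS (3 * v + 3) C /\ hamiltonian (BIG2 C).
Proof.
move=> _; have q_gt0 : 0 < v./2 by lia.
have -> : 3 * v + 3 = 6 * (v./2).+1 by lia.
by exists _, (blocks v./2); apply: blocks_TTS.
Qed.
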